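(* Let $K$ be a field and let $I$ be a monomial ideal of $S=K[x_1,\dots,x_n]$ that is a cone ideal. Then $I$ is a Lyubeznik ideal. Furthermore, the Lyubeznik resolution of $I$ is minimal under any total order $\prec$ on $G(I)$ in which the least element of $G(I)$ is an absolutely inner point.
   Context: For a monomial ideal $I$, $G(I)$ is its minimal set of monomial generators. For $A\subseteq G(I)$, the multidegree $m(A)$ is the least common multiple of the elements of $A$. A subset $C\subseteq G(I)$ is a cover of $u\in C$ if $u\mid m(C\setminus\{u\})$; $C$ is a cover if it is a cover of some $u\in C$. The complete cover induced by a cover $C$ is $\overline{C}=\{w\in G(I): w\mid m(C)\}$; a complete cover is a set of this form. For a cover $C$, an out set of $C$ is a subset $D\subseteq C$ with $m(D)=m(C)$ such that no proper subset of $D$ has multidegree $m(D)$. An inner point of $C$ is a point of $C$ lying in no out set of $C$. An element $u\in G(I)$ is an absolutely inner point if $u$ is an inner point of every complete cover; $\mathcal{A}(G(I))$ is the set of absolutely inner points. $I$ is a cone ideal if $\mathcal{A}(G(I))\neq\emptyset$. Let $\prec$ be a total order on $G(I)$, and let $\min$ denote least element under $\prec$. The Lyubeznik simplicial complex $L_{(I,\prec)}$ is the simplicial complex on $G(I)$ whose faces are the $F\subseteq G(I)$ such that for every nonempty $G\subseteq F$, $\min\{u\in G(I): u\mid m(G)\}\in G$. The Lyubeznik resolution of $I$ under $\prec$ is the free resolution $\cdots\to L_2\xrightarrow{\varphi_1}L_1\xrightarrow{\varphi_0}I\to0$, where $L_i$ is the free $S$-module with basis the faces $F\in L_{(I,\prec)}$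 with $|F|=i$, $\varphi_0(\{u\})=u$, and for a face $F=\{u_{j_1}\prec\cdots\prec u_{j_i}\}$ with $i\ge2$, $\varphi_{i-1}(F)=\sum_{k=1}^{i}(-1)^{k+1}\frac{m(F)}{m(G_k)}G_k$ with $G_k=F\setminus\{u_{j_k}\}$. It is known that this is a free resolution of $I$. It is minimal if $\varphi_{i-1}(L_i)\subseteq(x_1,\dots,x_n)L_{i-1}$ for all $i\ge2$. $I$ is a Lyubeznik ideal if there is a total order on $G(I)$ such that the corresponding Lyubeznik resolution of $I$ is minimal. *)

(* Defs.v *)
From HB Require Import structures.
From mathcomp Require Import all_boot all_order all_algebra.
From mathcomp Require Import finmap mpoly.
From Stdlib Require Import Classical ClassicalEpsilon.

Set Implicit Arguments.
Unset Strict Implicit.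
Unset Printing Implicit Defensive.

Import GRing.Theory.

Local Open Scope fset_scope.
Local Open Scope ring_scope.

(* Monomials of K[x_1, ..., x_n] are represented by their exponent vectors
   m : 'X_{1..n}, so that (m1 <= m2)%MM is the divisibility x^m1 | x^m2 and
   mlcm is the least common multiple. *)

Section MonomialIdeals.
Variables (K : fieldType) (n : nat).
Local Notation S := {mpoly K[n]}.

Definition ideal_gen (P : S -> Prop) (f : S) : Prop :=
  exists2 s : seq (S * S),
    (forall p, p \in s -> P p.2) & f = \sum_(p <- s) p.1 * p.2.

Definition mon_gen (M : 'X_{1..n} -> Prop) : S -> Prop :=
  ideal_gen (fun f => exists2 m, M m & f = 'X_[m]).

Definition generates (M : 'X_{1..n} -> Prop) (I : S -> Prop) : Prop :=
  forall f, I f <-> mon_gen M f.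

Definition monomial_ideal (I : S -> Prop) : Prop :=
  exists M : 'X_{1..n} -> Prop, generates M I.

Definition is_mingens (I : S -> Prop) (G : {fset 'X_{1..n}}) : Prop :=
  generates (fun m => m \in G) I /\
  forall H : {fset 'X_{1..n}}, H `<` G -> ~ generates (fun m => m \in H) I.

(* G(I); for a monomial ideal I, see mingensP and mingens_uniq below. *)
Definition mingens (I : S -> Prop) : {fset 'X_{1..n}} :=
  epsilon (inhabits fset0) (is_mingens I).

Lemma mon_gen_msupp M (f : S) :
  mon_gen M f -> forall m, m \in msupp f -> exists2 g, M g & (g <= m)%MM.
Proof.
case=> s hs ->; elim: s hs => [|[a b] s IH] hs m.
  by rewrite big_nil msupp0.
rewrite big_cons => /msuppD_le; rewrite mem_cat => /orP[|]; last first.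
  by apply: IH => p ps; apply: hs; rewrite inE ps orbT.
case: (hs (a, b) (mem_head _ _)) => g Mg /= -> /msuppM_le /allpairsP.
case=> -[m1 m2] /= [_]; rewrite msuppX inE => /eqP -> ->.
by exists g => //; apply: lem_addl.
Qed.

Lemma mon_gen_sum (M : 'X_{1..n} -> Prop) (J : eqType) (r : seq J) (F : J -> S) :
  (forall j, j \in r -> mon_gen M (F j)) -> mon_gen M (\sum_(j <- r) F j).
Proof.
elim: r => [|j r IH] h; first by rewrite big_nil; exists [::]; rewrite ?big_nil.
rewrite big_cons.
case: (h j (mem_head _ _)) => s1 h1 ->.
case: IH => [k kr|s2 h2 ->]; first by apply: h; rewrite inE kr orbT.
exists (s1 ++ s2); last by rewrite big_cat.
by move=> p; rewrite mem_cat => /orP[/h1|/h2].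
Qed.

Lemma mon_genP M (f : S) :
  mon_gen M f <-> forall m, m \in msupp f -> exists2 g, M g & (g <= m)%MM.
Proof.
split; first exact: mon_gen_msupp.
move=> h; rewrite (mpolyE f); apply: mon_gen_sum => m /h [g Mg gm].
exists [:: (f@_m *: 'X_[m - g], 'X_[g])].
  by move=> p; rewrite inE => /eqP -> /=; exists g.
by rewrite big_seq1 /= -scalerAl -mpolyXD submK.
Qed.

Lemma mon_genX M m :
  mon_gen M ('X_[m] : S) <-> exists2 g, M g & (g <= m)%MM.
Proof.
rewrite mon_genP; split=> [|h m']; first by apply; rewrite msuppX inE.
by rewrite msuppX inE => /eqP ->.
Qed.

Lemma mon_gen_le (M N : 'X_{1..n} -> Prop) (f : S) :
  (forall m, M m -> exists2 g, N g & (g <= m)%MM) ->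
  mon_gen M f -> mon_gen N f.
Proof.
move=> h /mon_genP hf; apply/mon_genP => m /hf [g /h [g' Ng' g'g] gm].
by exists g' => //; apply: lepm_trans gm.
Qed.

Lemma dickson (P : 'X_{1..n} -> Prop) :
  exists2 s : seq 'X_{1..n}, (forall m, m \in s -> P m) &
    forall m, P m -> exists2 g, g \in s & (g <= m)%MM.
Proof.
suff D k : forall Q : 'X_{1..n} -> Prop,
    exists2 s : seq 'X_{1..n}, (forall m, m \in s -> Q m) &
    forall m, Q m -> exists2 g, g \in s & forall i : 'I_n, (i < k)%N -> (g i <= m i)%N.
  have [s sP hs] := D n P; exists s => // m /hs [g gs hg].
  by exists g => //; apply/mnm_lepP => i; apply: hg.
elim: k => [|k IH] Q.
  case: (classic (exists m, Q m)) => [[m Qm]|nQ].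
    exists [:: m] => [m'|m' _]; first by rewrite inE => /eqP ->.
    by exists m; rewrite ?inE.
  by exists [::] => // m Qm; case: nQ; exists m.
have [kn|nk] := ltnP k n; last first.
  have [s sP hs] := IH Q; exists s => // m /hs [g gs hg]; exists g => // i _.
  by apply: hg; apply: leq_trans nk.
pose k' := Ordinal kn; have [s0 s0Q hs0] := IH Q.
pose N := (\max_(g <- s0) g k')%N.
have [t tQ ht] : exists2 t : seq 'X_{1..n}, (forall m, m \in t -> Q m) &
    forall m, Q m -> (m k' < N)%N ->
      exists2 g, g \in t & forall i : 'I_n, (i < k.+1)%N -> (g i <= m i)%N.
  elim: N => [|N [t tQ ht]]; first by exists [::].
  have [u uQ hu] := IH (fun m => Q m /\ m k' = N).
  exists (t ++ u) => [m|m Qm].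
    by rewrite mem_cat => /orP[/tQ|/uQ []].
  rewrite ltnS leq_eqVlt => /orP[/eqP mN|mN].
    have [g gu hg] := hu m (conj Qm mN).
    exists g => [|i]; first by rewrite mem_cat gu orbT.
    rewrite ltnS leq_eqVlt => /orP[/eqP ik|]; last exact: hg.
    have -> : i = k' by apply: val_inj.
    by rewrite mN; case: (uQ _ gu) => _ ->.
  by have [g gt hg] := ht m Qm mN; exists g; rewrite // mem_cat gt.
exists (s0 ++ t) => [m|m Qm].
  by rewrite mem_cat => /orP[/s0Q|/tQ].
have [mN|Nm] := ltnP (m k') N.
  by have [g gt hg] := ht m Qm mN; exists g; rewrite // mem_cat gt orbT.
have [g gs hg] := hs0 m Qm; exists g => [|i]; first by rewrite mem_cat gs.
rewrite ltnS leq_eqVlt => /orP[/eqP ik|]; last exact: hg.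
have -> : i = k' by apply: val_inj.
by apply: leq_trans Nm; exact: (@leq_bigmax_seq _ s0 xpredT (fun g : 'X_{1..n} => g k') g gs).
Qed.

Lemma mingens_ex I : monomial_ideal I -> exists G, is_mingens I G.
Proof.
case=> M hM; have [s sM hs] := dickson M.
pose G := [fset g in s | all (fun h => (h <= g)%MM ==> (h == g)) s].
have GP g : reflect (g \in s /\ forall h, h \in s -> (h <= g)%MM -> h = g) (g \in G).
  rewrite !inE; apply: (iffP andP) => -[gs h]; split=> //.
    by move=> k ks kg; apply/eqP; move/allP/(_ k ks)/implyP: h; apply.
  by apply/allP => k ks; apply/implyP => /(h _ ks) ->.
have sG d g : g \in s -> (mdeg g < d)%N -> exists2 h, h \in G & (h <= g)%MM.
  elim: d g => // d IH g gs; rewrite ltnS => gd.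
  have [|gG] := boolP (g \in G); first by exists g; rewrite ?lepm_refl.
  have [/hasP [h hs' /andP [hg hng]]|/hasPn nh] :=
    boolP (has (fun h => (h <= g)%MM && (h != g)) s).
    have /IH [|k kG kh] := hs'.
      apply: leq_trans gd; rewrite -(submK hg) mdegD -[X in (X < _)%N]add0n ltn_add2r.
      rewrite lt0n mdeg_eq0; apply: contra hng => /eqP e.
      by rewrite -(submK hg) e add0m.
    by exists k => //; apply: lepm_trans hg.
  case/GP: gG; split=> // h /nh; rewrite negb_and negbK => /orP[/negP //|/eqP //].
have MG m : M m -> exists2 g, g \in G & (g <= m)%MM.
  move=> /hs [g gs gm]; have [h hG hg] := sG _ _ gs (leqnn _).
  by exists h => //; apply: lepm_trans gm.
have genG : generates (fun m => m \in G) I.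
  move=> f; rewrite hM; split; apply: mon_gen_le => // m /GP [/sM Mm _].
  by exists m; rewrite ?lepm_refl.
exists G; split=> // H; rewrite fproperE => /andP [/fsubsetP HG /fsubsetPn [g gG gH]] genH.
have : mon_gen (fun m => m \in H) 'X_[g].
  by rewrite -genH genG; apply/mon_genX; exists g; rewrite ?lepm_refl.
move=> /mon_genX [h hH hg]; case/negP: gH.
have /GP [hs' _] := HG _ hH.
by case/GP: gG => _ /(_ _ hs' hg) <-.
Qed.

Lemma mingensP I : monomial_ideal I -> is_mingens I (mingens I).
Proof. by move=> hI; apply: epsilon_spec; apply: mingens_ex. Qed.

Lemma is_mingens_antichain I G : is_mingens I G ->
  forall g h, g \in G -> h \in G -> (h <= g)%MM -> h = g.
Proof.
move=> [genG minG] g h gG hG hg; apply/eqP/negPn/negP => hng.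
apply: (minG _ (fproperD1 gG)) => f; rewrite genG.
split; apply: mon_gen_le => m; last first.
  by rewrite !inE => /andP [_ mG]; exists m; rewrite ?lepm_refl.
have [-> _|mg mG] := eqVneq m g; first by exists h; rewrite // !inE hng.
by exists m; rewrite ?lepm_refl // !inE mg.
Qed.

Lemma is_mingens_uniq I G H : is_mingens I G -> is_mingens I H -> G = H.
Proof.
have sub A B : is_mingens I A -> is_mingens I B -> forall g, g \in A -> g \in B.
  move=> mA mB g gA.
  have /mon_genX [h hB hg] : mon_gen (fun m => m \in B) 'X_[g].
    by rewrite -mB.1 mA.1; apply/mon_genX; exists g; rewrite ?lepm_refl.
  have /mon_genX [k kA kh] : mon_gen (fun m => m \in A) 'X_[h].
    by rewrite -mA.1 mB.1; apply/mon_genX; exists h; rewrite ?lepm_refl.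
  have kg := is_mingens_antichain mA gA kA (lepm_trans kh hg).
  suff <- : h = g by [].
  by apply/mnmP => i; apply/eqP; rewrite eqn_leq (mnm_lepP hg) -{1}kg (mnm_lepP kh).
by move=> mG mH; apply/fsetP => g; apply/idP/idP; apply: sub.
Qed.

Lemma mingens_uniq I G : is_mingens I G -> mingens I = G.
Proof. by move=> mG; apply: is_mingens_uniq (mG); apply: epsilon_spec; exists G. Qed.

End MonomialIdeals.

Section Covers.
Variables (n : nat) (G : {fset 'X_{1..n}}).
Implicit Types (u : G) (A B C D : {set G}).

Definition mdegree A : 'X_{1..n} := \big[@mlcm n/0%MM]_(u in A) val u.

Definition cover_of C u := (u \in C) && (val u <= mdegree (C :\ u)%SET)%MM.

Definition is_cover C := [exists u, cover_of C u].

Definition cover_closure C : {set G} := [set w | (val w <= mdegree C)%MM]%SET.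

Definition complete_cover B :=
  [exists C : {set G}, is_cover C && (B == cover_closure C)].

Definition out_set C D :=
  [&& D \subset C, mdegree D == mdegree C &
      [forall E : {set G}, (E \proper D) ==> (mdegree E != mdegree D)]].

Definition inner_point C u :=
  (u \in C) && [forall D : {set G}, out_set C D ==> (u \notin D)].

Definition absolutely_inner u :=
  [forall C : {set G}, complete_cover C ==> inner_point C u].

End Covers.

Section Lyubeznik.
Variables (K : fieldType) (n : nat) (G : {fset 'X_{1..n}}) (le : rel G).
Local Notation S := {mpoly K[n]}.

Definition total_order : Prop :=
  [/\ total le, antisymmetric le & transitive le].

Definition is_min (P : pred G) (u : G) : bool :=
  P u && [forall w, P w ==> le u w].

Definition lyub_face (F : {set G}) : bool :=
  [forall H : {set G}, (H != set0) && (H \subset F) ==>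
    [exists u in H, is_min (fun w => (val w <= mdegree H)%MM) u]].

Definition lyub_faces (i : nat) : Type :=
  {F : {set G} | lyub_face F && (#|F| == i)}.
HB.instance Definition _ i := Finite.on (lyub_faces i).

(* The free S-module on the faces with i elements. *)
Definition lyub_mod (i : nat) := {ffun lyub_faces i -> S^o}.
HB.instance Definition _ i := GRing.Lmodule.on (lyub_mod i).

(* The basis vector of a face F with i elements (0 for any other set F). *)
Definition lyub_basis i (F : {set G}) : lyub_mod i :=
  [ffun H => (val H == F)%:R].

Lemma lyub_face_sub (F F' : {set G}) : F' \subset F -> lyub_face F -> lyub_face F'.
Proof.
move=> sF /forallP hF; apply/forallP => H; apply/implyP => /andP [H0 HF'].
by have /implyP := hF H; apply; rewrite H0 (subset_trans HF').
Qed.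

Lemma lyub_face_del i (F : lyub_faces i.+1) u : u \in val F ->
  lyub_face (val F :\ u)%SET && (#|(val F :\ u)%SET| == i).
Proof.
move=> uF; case/andP: (valP F) => Ff /eqP cF.
rewrite (lyub_face_sub (subD1set _ _) Ff) /=.
by have := cardsD1 u (val F); rewrite uF cF add1n => -[<-].
Qed.

(* The index k such that u = u_{j_k}, where F = {u_{j_1} < ... < u_{j_i}}. *)
Definition lyub_pos (F : {set G}) (u : G) : nat :=
  (index u (sort le (enum F))).+1.

(* The map phi_i : L_{i+1} -> L_i.  For i = 0, L_0 is free on the empty face
   and this is phi_0 : L_1 -> I, {u} |-> u, viewed as a map to S = L_0.
   As F :\ u is contained in F, the quotient m(F) / m(F :\ u) is the monomial
   whose exponent is the (non-truncating) difference of the exponents. *)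
Definition lyub_diff i (v : lyub_mod i.+1) : lyub_mod i :=
  \sum_(F : lyub_faces i.+1) v F *:
    \sum_(u in val F)
      ((-1) ^+ (lyub_pos (val F) u).+1
        * 'X_[mdegree (val F) - mdegree (val F :\ u)%SET])
        *: lyub_basis i (val F :\ u)%SET.

End Lyubeznik.

Section Minimality.
Variables (K : fieldType) (n : nat).
Local Notation S := {mpoly K[n]}.

Definition ideal_smul (J : S -> Prop) (V : lmodType S) (w : V) : Prop :=
  exists2 s : seq (S * V),
    (forall p, p \in s -> J p.1) & w = \sum_(p <- s) p.1 *: p.2.

Definition max_ideal : S -> Prop :=
  ideal_gen (fun f => exists i : 'I_n, f = 'X_i).

Variable I : S -> Prop.

Definition lyub_minimal (le : rel (mingens I)) : Prop :=
  forall i, (1 <= i)%N ->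
  forall v : lyub_mod K le i.+1, ideal_smul max_ideal (lyub_diff v).

Definition lyubeznik_ideal : Prop :=
  exists2 le : rel (mingens I), total_order le & lyub_minimal le.

Definition cone_ideal : Prop := exists u : mingens I, absolutely_inner u.

End Minimality.

(* Main.v *)
Require Import Defs.
From mathcomp Require Import all_boot all_order all_algebra.
From mathcomp Require Import finmap mpoly.

(* If m(F) = m(F \ v) for a face F of the Lyubeznik complex, then F is a cover.
   The least element u, being absolutely inner, is an inner point of the complete
   cover induced by F. An out set D of F is also an out set of that complete
   cover, so it misses u. But u divides m(F) = m(D), so u is the least divisor
   of m(D), and the face condition for D forces u to lie in D: a contradiction.
   Hence all the coefficients m(F) / m(F \ v) are nontrivial monomials. *)

Set Implicit Arguments.
Unset Strict Implicit.
Unset Printing Implicit Defensive.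

Import GRing.Theory.

Local Open Scope ring_scope.

Section Multidegree.
Variables (n : nat) (G : {fset 'X_{1..n}}).
Implicit Types (u : G) (A B C D : {set G}) (m : 'X_{1..n}).

(** Dividing [m] turns lcm into conjunction and the empty lcm, 1, into truth. *)
Lemma mdegree_leP A m :
  reflect (forall u, u \in A -> (val u <= m)%MM) (mdegree A <= m)%MM.
Proof.
rewrite /mdegree (big_morph (fun d => (d <= m)%MM) (id1 := true) (op1 := andb)).
- by rewrite big_andE; apply: forall_inP.
- by move=> x y; rewrite lem_mlcm.
- by apply/mnm_lepP => i; rewrite mnm0E.
Qed.

Lemma le_mdegree A u : u \in A -> (val u <= mdegree A)%MM.
Proof. exact: (mdegree_leP _ _ (lepm_refl _)). Qed.

Lemma mdegreeS A B : A \subset B -> (mdegree A <= mdegree B)%MM.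
Proof.
by move=> /subsetP sAB; apply/mdegree_leP => u /sAB; apply: le_mdegree.
Qed.

Lemma lepm_antisym m1 m2 : (m1 <= m2)%MM -> (m2 <= m1)%MM -> m1 = m2.
Proof.
move=> /mnm_lepP h12 /mnm_lepP h21; apply/mnmP => i.
by apply/eqP; rewrite eqn_leq h12 h21.
Qed.

Lemma sub_cover_closure C : C \subset cover_closure C.
Proof. by apply/subsetP => u /le_mdegree; rewrite inE. Qed.

Lemma mdegree_cover_closure C : mdegree (cover_closure C) = mdegree C.
Proof.
apply: lepm_antisym; last exact: mdegreeS (sub_cover_closure C).
by apply/mdegree_leP => u; rewrite inE.
Qed.

(** A subset of least cardinality among those with multidegree [mdegree C] works: a proper subset of
    it with the same multidegree would be smaller. *)
Lemma out_set_exists C : exists D, out_set C D.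
Proof.
pose P (D : {set G}) := (D \subset C) && (mdegree D == mdegree C).
have PC : P C by rewrite /P subxx eqxx.
case: (arg_minnP (fun D : {set G} => #|D|) PC) => D /andP [DC mD] minD.
exists D; rewrite /out_set DC mD /=; apply/forall_inP => E ED.
apply/eqP => mE; have := minD E.
rewrite /P mE mD (subset_trans (proper_sub ED) DC) => /(_ isT).
by rewrite leqNgt (proper_card ED).
Qed.

(** The closure enlarges [C] but keeps its multidegree, and the minimality condition involves [D]
    alone. *)
Lemma out_set_cover_closure C D : out_set C D -> out_set (cover_closure C) D.
Proof.
case/and3P => DC mD minD; rewrite /out_set mdegree_cover_closure mD minD.
by rewrite (subset_trans DC (sub_cover_closure C)).
Qed.

Lemma mdegree_eq0_card A : mdegree A = 0%MM -> (#|A| <= 1)%N.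
Proof.
move=> A0; have z u : u \in A -> val u = 0%MM.
  move=> /le_mdegree; rewrite A0 => uA; apply: lepm_antisym => //.
  by apply/mnm_lepP => i; rewrite mnm0E.
by apply/card_le1_eqP => u v /z u0 /z v0; apply: val_inj; rewrite u0 v0.
Qed.

Lemma mdegree_del_cover A u :
  u \in A -> mdegree (A :\ u)%SET = mdegree A -> is_cover A.
Proof.
move=> uA mA; apply/existsP; exists u.
by rewrite /cover_of uA mA le_mdegree.
Qed.

(** As the lcm of [A :\ u] divides that of [A], the subtraction does not truncate; a zero difference
    thus means equal multidegrees, which makes [A] a cover of [u]. *)
Lemma mdegree_sub_del_neq0 A u :
  u \in A -> ~~ is_cover A -> (mdegree A - mdegree (A :\ u)%SET)%MM != 0%MM.
Proof.
move=> uA; apply: contra => /eqP A0; apply: (mdegree_del_cover uA).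
by rewrite -[RHS](submK (mdegreeS (subD1set A u))) A0 add0m.
Qed.

Lemma lyub_face_not_cover (le : rel G) u (F : {set G}) :
  total_order le -> is_min le predT u -> absolutely_inner u ->
  lyub_face le F -> (1 < #|F|)%N -> ~~ is_cover F.
Proof.
move=> [_ anti_le _] /andP [_ /forallP min_u] /forallP inner_u face_F cardF.
apply/negP => coverF.
have /andP [] : inner_point (cover_closure F) u.
  apply: (implyP (inner_u _)); apply/existsP; exists F.
  by rewrite coverF eqxx.
rewrite inE => u_dvd /forallP u_out; have [D outD] := out_set_exists F.
have /negP := implyP (u_out D) (out_set_cover_closure outD); apply.
case/and3P: outD => DF /eqP mD _.
(* The face condition speaks only of nonempty sets. If [D] were empty, [F] would have multidegree 1
   and so contain at most the monomial 1, against [cardF]. *)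
have D0 : D != set0.
  apply: contraTneq cardF => D0; rewrite -leqNgt; apply: mdegree_eq0_card.
  by rewrite -mD D0 /mdegree big_set0.
have /exists_inP [w wD /andP [_ /forallP min_w]] :
    [exists w in D, is_min le (fun v : G => (val v <= mdegree D)%MM) w].
  by apply: (implyP (forallP face_F D)); rewrite D0.
suff -> : u = w by [].
by apply: anti_le; rewrite (implyP (min_u w)) // (implyP (min_w u)) // mD.
Qed.

Lemma total_order_min u : exists2 le : rel G, total_order le & is_min le predT u.
Proof.
(* The successor reserves rank 0 for [u], which keeps [r] injective and the induced order
   antisymmetric. *)
pose r (v : G) := if v == u then 0%N else (enum_rank v).+1.
have r_inj : injective r.
  move=> v w; rewrite /r; case: eqVneq => [->|_]; case: eqVneq => [->|_] //.
  by move=> [] /val_inj /enum_rank_inj.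
exists (fun v w => (r v <= r w)%N).
  split=> [v w|v w|w v x]; first exact: leq_total.
    by rewrite -eqn_leq => /eqP /r_inj.
  exact: leq_trans.
by apply/andP; split=> //; apply/forallP => w; rewrite /r eqxx.
Qed.

End Multidegree.

Section IdealSmul.
Variables (K : fieldType) (n : nat) (J : {mpoly K[n]} -> Prop).
Variable V : lmodType {mpoly K[n]}.

Lemma ideal_smul_sum (T : Type) (r : seq T) (P : pred T) (F : T -> V) :
  (forall j, P j -> ideal_smul J (F j)) ->
  ideal_smul J (\sum_(j <- r | P j) F j).
Proof.
move=> JF; apply: big_ind => //; first by exists [::]; rewrite ?big_nil.
move=> _ _ [s Js ->] [t Jt ->]; exists (s ++ t); last by rewrite big_cat.
by move=> p; rewrite mem_cat => /orP [/Js|/Jt].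
Qed.

(** The form [a * x] matches the coefficients of [lyub_diff]: a sign times a monomial. *)
Lemma ideal_smulZ a x (w : V) : J x -> ideal_smul J ((a * x) *: w).
Proof.
move=> Jx; exists [:: (x, a *: w)]; first by move=> p; rewrite inE => /eqP ->.
by rewrite big_seq1 /= scalerA mulrC.
Qed.

Lemma ideal_smul_scale a (w : V) : ideal_smul J w -> ideal_smul J (a *: w).
Proof.
case=> s Js ->; rewrite scaler_sumr.
exists [seq (p.1, a *: p.2) | p <- s]; first by move=> p /mapP [q /Js Jq ->].
by rewrite big_map; apply: eq_bigr => p _; rewrite !scalerA mulrC.
Qed.

End IdealSmul.

(** Some exponent of [m] is positive, so the corresponding variable can be factored out. *)
Lemma max_idealX (K : fieldType) (n : nat) (m : 'X_{1..n}) :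
  m != 0%MM -> max_ideal ('X_[m] : {mpoly K[n]}).
Proof.
rewrite -mdeg_eq0 mdegE sum_nat_eq0 negb_forall => /existsP [i mi].
exists [:: ('X_[m - U_(i)], 'X_i)].
  by move=> p; rewrite inE => /eqP ->; exists i.
by rewrite big_seq1 /= -mpolyXD submK // lep1mP.
Qed.

Theorem proposition5p1 (K : fieldType) (n : nat) (I : {mpoly K[n]} -> Prop)
    (monI : monomial_ideal I) (coneI : cone_ideal I) :
  lyubeznik_ideal I /\
  (forall le : rel (mingens I), total_order le ->
   forall u : mingens I, is_min le predT u -> absolutely_inner u ->
   lyub_minimal le).
Proof.
suff minimal : forall le : rel (mingens I), total_order le ->
    forall u, is_min le predT u -> absolutely_inner u -> lyub_minimal le.
  split=> //; case: coneI => u inner_u.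
  have [le ord_le min_u] := total_order_min u.
  by exists le => //; apply: minimal inner_u.
move=> le ord_le u min_u inner_u i i1 v.
apply: ideal_smul_sum => F _; apply/ideal_smul_scale/ideal_smul_sum => w wF.
apply/ideal_smulZ/max_idealX/mdegree_sub_del_neq0 => //.
case/andP: (valP F) => face_F /eqP cardF.
(* [F] has [i.+1] elements, so [i1] gives it at least two. *)
by apply: lyub_face_not_cover inner_u face_F _ => //; rewrite cardF ltnS.
Qed.
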